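(* Let $\langle\mathfrak{B},\Diamond\rangle$ be a complete KTB-algebra (i.e. a KTB-algebra whose underlying Boolean algebra is complete). Then $$\mathsf{C}_{\diamond}=\{\langle x,y\rangle\in B\times B\mid x\cdot\Diamond y\neq\mathbf{0}\}$$ is a contact relation on $\mathfrak{B}$ that satisfies (C4$^c$). Moreover $\Diamond=m$, where $m\colon B\to B$ is the operator assigning to each $x\in B$ the unique $y\in B$ such that $\{z\in B\mid z\mathrel{\mathsf{C}_{\diamond}}x\}=\{z\in B\mid z\cdot y\neq\mathbf{0}\}$.
   Context: A possibility operator on a Boolean algebra $\mathfrak{B}=\langle B,\cdot,+,-,\mathbf{0},\mathbf{1}\rangle$ is a map $\Diamond\colon B\to B$ with $\Diamond\mathbf{0}=\mathbf{0}$ and $\Diamond(x+y)=\Diamond x+\Diamond y$. A KTB-algebra is a modal algebra $\langle\mathfrak{B},\Diamond\rangle$, with $\Diamond$ a possibility operator, such that $x\leq\Diamond x$ and $\Diamond\Box x\leq x$ for all $x\in B$, where $\Box x=-\Diamond(-x)$. A contact relation on $\mathfrak{B}$ is a relation $\mathsf{C}\subseteq B\times B$ satisfying, for all $x,y,z\in B$: (C0) not $\mathbf{0}\mathrel{\mathsf{C}}x$; (C1) if $x\le y$ and $x\ne\mathbf{0}$, then $x\mathrel{\mathsf{C}}y$; (C2) if $x\mathrel{\mathsf{C}}y$, then $y\mathrel{\mathsf{C}}x$; (C3) if $x\le y$ and $z\mathrel{\mathsf{C}}x$, then $z\mathrel{\mathsf{C}}y$; (C4) if $x\mathrel{\mathsf{C}}(y+z)$,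 then $x\mathrel{\mathsf{C}}y$ or $x\mathrel{\mathsf{C}}z$. (C4$^c$): for every $x\in B$ and every $J\subseteq B$, if $x\mathrel{\mathsf{C}}\bigvee J$, then there is $y\in J$ with $x\mathrel{\mathsf{C}}y$. *)

(* Defs.v *)
From HB Require Import structures.
From mathcomp Require Import all_boot all_order.
From mathcomp Require Import boolp classical_sets.

Set Implicit Arguments.
Unset Strict Implicit.
Unset Printing Implicit Defensive.

(* Boolean algebras are the complemented distributive lattices
   [ctbDistrLatticeType]; [\bot = \top] is not excluded. *)

Definition complete_lattice (d : Order.disp_t) (B : ctbDistrLatticeType d) :
    Prop :=
  forall J : set B, nonempty (supremums J).

(* The default value [\bot] of [supremum] is the join of the empty set. *)
Definition bigjoin (d : Order.disp_t) (B : ctbDistrLatticeType d)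
    (J : set B) : B :=
  supremum (\bot : B)%O J.

Definition possibility_operator (d : Order.disp_t) (B : ctbDistrLatticeType d)
    (dia : B -> B) : Prop :=
  (dia \bot = \bot)%O /\ (forall x y : B, dia (x `|` y) = dia x `|` dia y)%O.

Definition necessity (d : Order.disp_t) (B : ctbDistrLatticeType d)
    (dia : B -> B) (x : B) : B :=
  (~` dia (~` x))%O.

Record KTB_algebra (d : Order.disp_t) (B : ctbDistrLatticeType d)
    (dia : B -> B) : Prop := {
  KTB_possibility : possibility_operator dia;
  KTB_T : forall x : B, (x <= dia x)%O;
  KTB_B : forall x : B, (dia (necessity dia x) <= x)%O
}.

Record contact_relation (d : Order.disp_t) (B : ctbDistrLatticeType d)
    (C : B -> B -> Prop) : Prop := {
  contact_C0 : forall x : B, ~ C \bot%O x;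
  contact_C1 : forall x y : B, (x <= y)%O -> x <> \bot%O -> C x y;
  contact_C2 : forall x y : B, C x y -> C y x;
  contact_C3 : forall x y z : B, (x <= y)%O -> C z x -> C z y;
  contact_C4 : forall x y z : B, C x (y `|` z)%O -> C x y \/ C x z
}.

Definition contact_C4c (d : Order.disp_t) (B : ctbDistrLatticeType d)
    (C : B -> B -> Prop) : Prop :=
  forall (x : B) (J : set B), C x (bigjoin J) -> exists2 y : B, J y & C x y.

Definition dia_contact (d : Order.disp_t) (B : ctbDistrLatticeType d)
    (dia : B -> B) (x y : B) : Prop :=
  (x `&` dia y)%O <> \bot%O.

Definition contact_repr (d : Order.disp_t) (B : ctbDistrLatticeType d)
    (C : B -> B -> Prop) (x y : B) : Prop :=
  [set z : B | C z x]%classic = [set z : B | (z `&` y)%O <> \bot%O]%classic.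

(* The default value [\bot] is taken only where no [y] represents [x]. *)
Definition contact_operator (d : Order.disp_t) (B : ctbDistrLatticeType d)
    (C : B -> B -> Prop) (x : B) : B :=
  xget (\bot : B)%O (contact_repr C x).

(* Main.v *)
Require Import Defs.
From mathcomp Require Import all_boot all_order.
From mathcomp Require Import boolp classical_sets.

Import Order.Theory.

(** The operator [dia] is self-conjugate: [x . dia y = 0] means
    [x <= nec (- y)], hence [dia x <= dia (nec (- y)) <= - y], that is
    [dia x . y = 0]. Self-conjugacy makes [dia_contact] symmetric; it also
    turns "no [y] in [J] is in contact with [x]" into "[- dia x] is an upper
    bound of [J]", which gives (C4^c). An element [y] is determined by
    [{z | z . y <> 0}], so [dia x] is the only representative of [x]. *)

Section ContactRepr.
Local Open Scope order_scope.
Context (d : Order.disp_t) (B : ctbDistrLatticeType d).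

(** Test with [z] the complement of [y']: it misses [y'], hence misses [y]. *)
Lemma overlap_le (y y' : B) :
  (forall z : B, z `&` y <> \bot -> z `&` y' <> \bot) -> y <= y'.
Proof.
move=> yy'; rewrite -[y']complK -disj_leC meetC.
by apply/eqP; apply: contrapT => yz; apply: (yy' _ yz); rewrite meetC meetxC.
Qed.

Lemma contact_repr_inj (C : B -> B -> Prop) (x y y' : B) :
  contact_repr C x y -> contact_repr C x y' -> y = y'.
Proof.
rewrite /contact_repr => -> /seteqP[yy' y'y].
by apply/le_anti/andP; split; apply: overlap_le.
Qed.

(** Once a representative exists, [xget] returns one, and uniqueness forces it to be [y]. *)
Lemma contact_operatorE (C : B -> B -> Prop) (x y : B) :
  contact_repr C x y -> contact_operator C x = y.
Proof.
by move=> xy; apply: xget_unique => // y' xy'; apply: contact_repr_inj xy' xy.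
Qed.

Lemma bigjoin_le (J : set B) (b : B) :
  complete_lattice B -> (forall y, J y -> y <= b) -> bigjoin J <= b.
Proof.
(* For empty [J] the value is the default [\bot]; otherwise completeness makes [xget] return a least
   upper bound. *)
move=> hB Jb; rewrite /bigjoin /supremum; case: ifP => _; first exact: le0x.
by case: (xgetPex \bot (hB J)) => _; apply.
Qed.

End ContactRepr.

Section KTB.
Local Open Scope order_scope.
Context (d : Order.disp_t) (B : ctbDistrLatticeType d).
Context (dia : B -> B) (hdia : KTB_algebra dia).

Lemma dia_homo : {homo dia : x y / x <= y}.
Proof.
have [_ diaU] := KTB_possibility hdia.
by move=> x y /join_idPl <-; rewrite diaU leUr.
Qed.

Lemma dia_conjugate (x y : B) : x `&` dia y = \bot -> dia x `&` y = \bot.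
Proof.
move=> /eqP; rewrite disj_leC => xy; apply/eqP; rewrite disj_leC.
apply: le_trans (KTB_B hdia (~` y)); apply: dia_homo.
by rewrite /necessity complK.
Qed.

Lemma dia_contact_sym (x y : B) : dia_contact dia x y -> dia_contact dia y x.
Proof. by move=> xy /dia_conjugate; rewrite meetC. Qed.

Lemma dia_contact_relation : contact_relation (dia_contact dia).
Proof.
have [_ diaU] := KTB_possibility hdia.
split.
- by move=> x; apply; rewrite meet0x.
- move=> x y xy x0; rewrite /dia_contact.
  by have /meet_idPl -> := le_trans xy (KTB_T hdia y).
- exact: dia_contact_sym.
- move=> x y z /dia_homo xy zx zy; apply: zx; apply/eqP.
  by rewrite -lex0 -zy leI2.
- move=> x y z; rewrite /dia_contact diaU meetUr => xyz.
  have [xy|] := pselect (x `&` dia y = \bot); last by left.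
  by right => xz; apply: xyz; rewrite xy xz joinx0.
Qed.

Lemma dia_contact_C4c : complete_lattice B -> contact_C4c (dia_contact dia).
Proof.
(* Symmetry puts [dia] on [x] rather than on the join, so no infinite join has to pass through
   [dia]. *)
move=> hB x J /dia_contact_sym xJ; apply: contrapT => nJ; apply: xJ.
apply/eqP; rewrite disj_leC; apply: bigjoin_le => // y Jy.
rewrite -disj_leC meetC; apply/eqP/dia_conjugate; apply: contrapT => xy.
by apply: nJ; exists y.
Qed.

(** Both sets unfold to the [z] whose meet with [dia x] is not [\bot], so they agree by
    conversion. *)
Lemma dia_contact_repr (x : B) : contact_repr (dia_contact dia) x (dia x).
Proof. by []. Qed.

End KTB.

Theorem lemma6p12 (d : Order.disp_t) (B : ctbDistrLatticeType d)
    (dia : B -> B) (hB : complete_lattice B) (hdia : KTB_algebra dia) :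
  contact_relation (dia_contact dia) /\
  contact_C4c (dia_contact dia) /\
  (forall x : B, exists! y : B, contact_repr (dia_contact dia) x y) /\
  dia = contact_operator (dia_contact dia).
Proof.
split; first exact: dia_contact_relation.
split; first exact: dia_contact_C4c.
split=> [x|].
  exists (dia x); split=> // y; exact: contact_repr_inj.
by apply/funext => x; apply/esym/contact_operatorE/dia_contact_repr.
Qed.
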